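(* There exist constants $0<C,c<\infty$ such that, for infinitely many $n\in\mathbb{N}$, there exists $f\colon\{-1,1\}^n\to\{-1,1\}$ with $\mathbb{E}[fW_S]=0$ for all $S\subseteq\{1,\ldots,n\}$ with $|S|\le c\log n$, and such that $$\max_{i=1,\ldots,n}I_i(f)\le C\,\frac{\log n}{n}.$$
   Context: $\{-1,1\}^n$ carries the uniform probability measure and $\mathbb{E}$ is expectation with respect to it. $W_S(x)=\prod_{i\in S}x_i$ for $S\subseteq\{1,\ldots,n\}$ (with $W_\emptyset=1$, so the condition includes $\mathbb{E}f=0$). The $i$-th influence of $f$ is $I_i(f)=\mathbb{P}[f(x_1,\ldots,x_{i-1},x_i,x_{i+1},\ldots,x_n)\ne f(x_1,\ldots,x_{i-1},y,x_{i+1},\ldots,x_n)]$, where $x_1,\ldots,x_n,y$ are i.i.d. uniform on $\{-1,1\}$. *)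

(* Defs.v *)
From mathcomp Require Import all_boot all_order all_algebra.
From mathcomp Require Import reals.

Set Implicit Arguments.
Unset Strict Implicit.
Unset Printing Implicit Defensive.

Import Order.TTheory GRing.Theory Num.Theory.
Local Open Scope ring_scope.

(* The two-point set {-1, 1} is encoded as bool, a boolean b standing for the
   sign (-1) ^+ b; thus false is 1 and true is -1. *)
Definition sgn (R : realType) (b : bool) : R := (-1) ^+ b.

Definition cube (n : nat) : finType := {ffun 'I_n -> bool}.

Definition expectation (R : realType) (T : finType) (g : T -> R) : R :=
  (\sum_(t : T) g t) / #|T|%:R.

Definition probability (R : realType) (T : finType) (A : pred T) : R :=
  #|A|%:R / #|T|%:R.

Definition walsh (R : realType) (n : nat) (S : {set 'I_n}) (x : cube n) : R :=
  \prod_(i in S) sgn R (x i).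

Definition replace (n : nat) (x : cube n) (i : 'I_n) (y : bool) : cube n :=
  [ffun j => if j == i then y else x j].

(* For x_1, ..., x_n, y i.i.d. uniform signs, the pair ((x_1, ..., x_n), y) is
   uniform on the product. *)
Definition influence (R : realType) (n : nat) (f : cube n -> bool) (i : 'I_n) :
    R :=
  probability R [pred p : cube n * bool | f p.1 != f (replace p.1 i p.2)].

(* Influences are nonnegative, so the default value 0 only matters for n = 0. *)
Definition max_influence (R : realType) (n : nat) (f : cube n -> bool) : R :=
  \big[Num.max/0]_(i < n) influence R f i.

(* Main.v *)
(* Let [M = 2 ^ k] and split the coordinates into [M] address words and [M] data
   blocks, all of length [k].  The address words select the block whose word is
   minimal, ties being broken by the index of the block, and [f] is the parity
   of the selected data block.

   If [#|S| < k], every data block has a coordinate outside [S]; flipping that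
   coordinate of the selected block is an involution which changes the sign of
   [f] and preserves [W_S], so [f W_S] has mean zero.

   A change in the address word or the data block of index [b] affects [f] only
   if [b] is selected before or after the change, so all influences are at most
   twice the probability that [b] is selected.  This is at most
   [\sum_(u < M) ((u + 1) / M) ^ (M - 1) / M <= (1 + 1 / M) ^ M / M <= e / M],
   and the number of coordinates is [2 k M]. *)
Require Import Defs.
From mathcomp Require Import all_boot all_order all_algebra.
From mathcomp Require Import reals exp.
From mathcomp Require Import sequences ring lra zify.

Set Implicit Arguments.
Unset Strict Implicit.
Unset Printing Implicit Defensive.

Import Order.TTheory GRing.Theory Num.Theory.
Local Open Scope ring_scope.

(** * Counting and exponential estimates *)

Lemma cards_ord_geq (n a : nat) : #|[pred i : 'I_n | (a <= i)%N]| = (n - a)%N.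
Proof.
rewrite -sum1_card big_mkcond /=.
elim: n => [|n IHn]; first by rewrite big_ord0.
by rewrite big_ord_recr /= IHn inE /=; case: (leqP a n); lia.
Qed.

(* The binomial expansion gives [m * u ^ (m - 1) <= (u + 1) ^ m - u ^ m], which
   telescopes. *)
Lemma leq_sum_expn (m n : nat) :
  (m * \sum_(u < n) u.+1 ^ m.-1 <= n.+1 ^ m)%N.
Proof.
case: m => [|m] /=; first by rewrite mul0n.
elim: n => [|n IHn]; first by rewrite big_ord0 muln0.
rewrite big_ord_recr mulnDr /=; apply: (leq_trans (leq_add IHn (leqnn _))).
rewrite -[n.+2]addn1 expnDn 2!big_ord_recl /= /bump /= !exp1n !muln1 bin0 bin1.
by rewrite mul1n !subn0 subSS subn0 addnA leq_addr.
Qed.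

(** Sort the functions by the value [v] at [j]: each of the other [#|T| - 1] values is then free
    among the [#|T| - enum_rank v] elements ranked no lower than [v]. *)
Lemma card_minimal_at (T : finType) (j : T) :
  (#|T| * #|[pred y : {ffun T -> T} |
              [forall i, enum_rank (y j) <= enum_rank (y i)]]| <= #|T|.+1 ^ #|T|)%N.
Proof.
set A := [pred y | _].
pose F (v i : T) := [pred w : T | if i == j then w == v else
                                  (enum_rank v <= enum_rank w)%N].
have cardF v : #|[pred y | A y & y j == v]| = ((#|T| - enum_rank v) ^ #|T|.-1)%N.
  rewrite (eq_card (B := family (F v))) => [|y].
    rewrite card_family foldrE big_map big_enum /= (bigD1 j) //=.
    rewrite (eq_card (B := pred1 v)) => [|w]; last by rewrite !inE /= eqxx.
    rewrite card1 mul1n (eq_bigr (fun=> (#|T| - enum_rank v)%N)) => [|i /negPf ij].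
      by rewrite prod_nat_const cardC1.
    rewrite -cards_ord_geq -(card_image (@enum_rank_inj T)); apply: eq_card => r.
    rewrite inE; apply/imageP/idP => [[w]|rv].
      by rewrite unfold_in /= ij => ? ->.
    by exists (enum_val r); rewrite ?enum_valK // unfold_in /= ij enum_valK.
  rewrite !inE; apply/andP/familyP => [[/forallP yA /eqP yj] i|yF].
    by rewrite inE; case: eqP => [->|_]; rewrite -?yj.
  have /eqP yj : y j == v by have := yF j; rewrite inE eqxx.
  split; last exact/eqP.
  by apply/forallP => i; have := yF i; rewrite inE yj; case: eqP => // -> /eqP->.
have -> : #|A| = (\sum_(v : T) (#|T| - enum_rank v) ^ #|T|.-1)%N.
  rewrite -[#|A|]sum1_card (partition_big (fun y : {ffun T -> T} => y j) predT) //=.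
  by apply: eq_bigr => v _; rewrite sum1_card cardF.
rewrite (reindex_onto (@enum_val T predT) enum_rank) /=; last first.
  by move=> v _; rewrite enum_rankK.
rewrite (eq_bigl predT) => [|r]; last by rewrite enum_valK eqxx.
(* Reversing the ranks turns [#|T| - r] into [r + 1], the summand of [leq_sum_expn]. *)
rewrite (reindex_inj rev_ord_inj) /=; apply: (leq_trans _ (leq_sum_expn _ _)).
rewrite leq_mul2l; apply/orP; right; apply: leq_sum => r _.
by rewrite enum_valK /= subKn.
Qed.

(** For [m > 0], raise [1 + 1 / m <= expR (1 / m)] to the power [m]. *)
Lemma exprS_le_expR (R : realType) (m : nat) :
  (m.+1 ^ m)%:R <= expR 1 * (m ^ m)%:R :> R.
Proof.
case: m => [|m].
  by rewrite mulr1 (le_trans _ (expR_ge1Dx 1)) // lerDl.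
have m0 : 0 < m.+1%:R :> R by [].
rewrite !natrX -ler_pdivrMr ?exprn_gt0 // -expr_div_n.
have -> : m.+2%:R / m.+1%:R = 1 + m.+1%:R^-1 :> R.
  by rewrite -[m.+2]addn1 natrD mulrDl divff ?mul1r // gt_eqF.
have -> : expR 1 = expR (m.+1%:R^-1) ^+ m.+1 :> R.
  by rewrite -expRM_natl mulfV // gt_eqF.
by rewrite lerXn2r ?nnegrE ?expR_ge0 ?expR_ge1Dx // addr_ge0 // invr_ge0 ltW.
Qed.

(** * The function and the stability of its selection rule *)

(** The boolean is [false] for address bits and [true] for data bits. Blocks are indexed by [cube k]
    itself, so the address words form a function from [cube k] to [cube k]. *)
Definition coord (k : nat) : finType := (bool * (cube k * 'I_k))%type.

Definition word (k : nat) (x : cube #|coord k|) (s : bool) (b : cube k) :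
    cube k :=
  [ffun t => x (enum_rank ((s, (b, t)) : coord k))].

(* Lexicographic in (address word, block), so that the minimizer is unique. *)
Definition key (k : nat) (x : cube #|coord k|) (b : cube k) : nat :=
  (enum_rank (word x false b) * #|cube k| + enum_rank b)%N.

(** The constant word only witnesses that there is a block. *)
Definition selected (k : nat) (x : cube #|coord k|) : cube k :=
  [arg min_(b < [ffun=> false] : cube k) key x b].

Definition selected_parity (k : nat) (x : cube #|coord k|) : bool :=
  \big[addb/false]_(t < k) word x true (selected x) t.

Lemma card_coord (k : nat) : #|coord k| = (2 * (2 ^ k * k))%N.
Proof. by rewrite !card_prod card_bool card_ffun card_bool !card_ord. Qed.

Lemma selected_min (k : nat) (x : cube #|coord k|) (b : cube k) :
  (key x (selected x) <= key x b)%N.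
Proof. by rewrite /selected; case: arg_minnP => // a _; apply. Qed.

Lemma key_inj (k : nat) (x : cube #|coord k|) : injective (key x).
Proof.
move=> a b /(congr1 (modn^~ #|cube k|)).
by rewrite /key !modnMDl !modn_small ?ltn_ord // => /ord_inj /enum_rank_inj.
Qed.

Lemma selected_minimal (k : nat) (x : cube #|coord k|) (b : cube k) :
  (enum_rank (word x false (selected x)) <= enum_rank (word x false b))%N.
Proof.
have /(leq_div2r #|cube k|) := selected_min x b.
have M0 : (0 < #|cube k|)%N by exact: (leq_ltn_trans (leq0n _) (ltn_ord (enum_rank b))).
by rewrite /key !divnMDl // !divn_small ?ltn_ord // !addn0.
Qed.

(** Both winners differ from [b], so each has the same key under [x] and [x']; minimality on both
    sides makes these keys equal, and keys are injective. *)
Lemma selected_uniq (k : nat) (x x' : cube #|coord k|) (b : cube k) :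
    (forall a, a != b -> word x false a = word x' false a) ->
  selected x != b -> selected x' != b -> selected x = selected x'.
Proof.
move=> xx' sb sb'; apply: (@key_inj _ x); apply/eqP; rewrite eqn_leq selected_min.
have keyE a : a != b -> key x a = key x' a by move=> /xx' e; rewrite /key e.
by rewrite !keyE // selected_min.
Qed.

Lemma eq_selected (k : nat) (x x' : cube #|coord k|) :
  word x false =1 word x' false -> selected x = selected x'.
Proof.
move=> xx'; apply: (@key_inj _ x); apply/eqP; rewrite eqn_leq selected_min.
have keyE a : key x a = key x' a by rewrite /key xx'.
by rewrite !keyE selected_min.
Qed.

Lemma word_replace (k : nat) (x : cube #|coord k|) (e : coord k) (y s : bool)
    (b : cube k) :
  (s, b) != (e.1, e.2.1) -> word (replace x (enum_rank e) y) s b = word x s b.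
Proof.
move=> ne; apply/ffunP => t; rewrite !ffunE (inj_eq enum_rank_inj).
by case: eqP => // eqe; rewrite -eqe eqxx in ne.
Qed.

Lemma selected_parity_replace (k : nat) (x : cube #|coord k|) (e : coord k)
    (y : bool) :
    selected_parity x != selected_parity (replace x (enum_rank e) y) ->
  (selected x == e.2.1) || (selected (replace x (enum_rank e) y) == e.2.1).
Proof.
apply: contraR; rewrite negb_or => /andP[nx nx']; apply/eqP.
have eqs : selected x = selected (replace x (enum_rank e) y).
  apply: (selected_uniq (b := e.2.1)) => // a ae; rewrite word_replace //.
  by rewrite xpair_eqE (negPf ae) andbF.
rewrite /selected_parity -eqs word_replace //.
by rewrite xpair_eqE (negPf nx) andbF.
Qed.

(** * Selection probability and influences *)

(** With denominators cleared, this bounds the probability of selecting [b] by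
    [(M + 1) ^ M / M ^ (M + 1)]. Split [x] into its address and data functions: selecting [b] forces
    the address function to be minimal at [b], and the [M ^ M] data functions are unrestricted. *)
Lemma card_selected (k : nat) (b : cube k) :
  (#|cube k| * #|[pred x | selected x == b]| * #|cube k| ^ #|cube k|
   <= #|cube k|.+1 ^ #|cube k| * #|cube #|coord k| |)%N.
Proof.
set M := #|cube k|.
set A := [pred y : {ffun cube k -> cube k} |
           [forall i, (enum_rank (y b) <= enum_rank (y i))%N]].
pose split (x : cube #|coord k|) :=
  ([ffun a => word x false a], [ffun a => word x true a])
    : {ffun cube k -> cube k} * {ffun cube k -> cube k}.
have split_inj : injective split.
  move=> x x' [/ffunP e0 /ffunP e1]; apply/ffunP => i.
  rewrite -(enum_valK i); case: (enum_val i) => -[] [a t].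
    by have /ffunP/(_ t) := e1 a; rewrite !ffunE.
  by have /ffunP/(_ t) := e0 a; rewrite !ffunE.
have ME : M = (2 ^ k)%N by rewrite /M card_ffun card_bool card_ord.
have -> : #|cube #|coord k| | = (M ^ M * M ^ M)%N.
  rewrite card_ffun card_bool card_ord -expnD addnn -mul2n card_coord {1}ME.
  by rewrite -expnM -ME; congr (2 ^ _)%N; lia.
have le_selA : (#|[pred x | selected x == b]| <= #|A| * M ^ M)%N.
  have -> : (#|A| * M ^ M)%N = #|[predX A & predT : pred {ffun cube k -> cube k}]|.
    by rewrite cardX card_ffun.
  rewrite -(card_image split_inj); apply/subset_leq_card/subsetP => _ /imageP[x + ->].
  rewrite !inE => /eqP <- /=; rewrite andbT.
  by apply/forallP => i; rewrite !ffunE selected_minimal.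
rewrite mulnA leq_mul2r; apply/orP; right.
apply: (leq_trans _ (leq_mul (card_minimal_at b) (leqnn _))).
by rewrite -mulnA leq_mul2l le_selA orbT.
Qed.

(* Exchanges [x i] and the independent copy [y] of it. *)
Definition exchange (n : nat) (i : 'I_n) (p : cube n * bool) : cube n * bool :=
  (replace p.1 i p.2, p.1 i).

Lemma exchangeK (n : nat) (i : 'I_n) : involutive (exchange i).
Proof.
case=> x y; congr pair; rewrite /= ?ffunE ?eqxx //.
by apply/ffunP => j; rewrite !ffunE; case: eqP => // ->.
Qed.

(** The event that [b] is selected after the change is the preimage under the bijection [exchange i]
    of the event that it is selected before, so both have the same size; a union bound gives the
    factor 2. *)
Lemma influence_le_selected (R : realType) (k : nat) (i : 'I_#|coord k|) :
  influence R (@selected_parity k) i <=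
  2 * probability R [pred x | selected x == (enum_val i).2.1].
Proof.
set b := _.2.1; set A := [pred x | selected x == b].
pose B := [pred p : cube #|coord k| * bool | A p.1].
have cardB : #|B| = (#|A| * 2)%N.
  rewrite -[2%N]card_bool -cardX; apply: eq_card => p.
  by rewrite !inE andbT.
have cardeB : #|[pred p | B (exchange i p)]| = #|B|.
  rewrite -(card_image (inv_inj (@exchangeK _ i))); apply: eq_card => p.
  apply/imageP/idP => [[q qB ->] //|]; rewrite -{1}[p](exchangeK i) => pB.
  by exists (exchange i p); rewrite ?exchangeK.
rewrite /influence /probability; set D := [pred p | _ != _].
set Q := #|cube _|; have Q0 : 0 < Q%:R :> R.
  by rewrite ltr0n /Q card_ffun card_bool expn_gt0.
rewrite [X in _ / X%:R <= _](_ : _ = Q * 2)%N; last first.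
  by rewrite card_prod card_bool.
rewrite natrM ler_pdivrMr ?mulr_gt0 //.
have -> : 2 * (#|A|%:R / Q%:R) * (Q%:R * 2) = (#|A| * 2 * 2)%:R :> R.
  by rewrite !natrM; field; rewrite gt_eqF.
rewrite ler_nat.
apply: (@leq_trans #|[predU B & [pred p | B (exchange i p)]]|).
  apply/subset_leq_card/subsetP => p; rewrite !inE /= -{1}(enum_valK i).
  by move=> /selected_parity_replace; rewrite enum_valK.
by apply: leq_trans (leq_addr #|predI B [pred p | B (exchange i p)]| _) _;
  rewrite cardUI cardeB cardB; lia.
Qed.

Lemma probability_selected (R : realType) (k : nat) (b : cube k) :
  probability R [pred x | selected x == b] <= expR 1 / (2 ^ k)%:R.
Proof.
have ME : #|cube k| = (2 ^ k)%N by rewrite card_ffun card_bool card_ord.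
have := card_selected b; rewrite ME; set M := (2 ^ k)%N; set a := #|_|; set Q := #|_|.
have M0 : (0 < M)%N by rewrite expn_gt0.
have Q0 : (0 < Q)%N by rewrite /Q card_ffun card_bool expn_gt0.
rewrite -(ler_nat R) !natrM => le1; rewrite /probability -/a -/Q.
have MM0 : 0 < (M ^ M)%:R :> R by rewrite ltr0n expn_gt0 M0.
rewrite ler_pdivrMr ?ltr0n // mulrAC ler_pdivlMr ?ltr0n //.
rewrite -(ler_pM2r MM0) [a%:R * _]mulrC; apply: (le_trans le1).
by rewrite mulrAC ler_wpM2r // exprS_le_expR.
Qed.

(** * Vanishing of the low-degree Walsh coefficients *)

Lemma expectation_selected_parity (R : realType) (k : nat)
    (S : {set 'I_#|coord k|}) :
    (#|S| < k)%N ->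
  expectation (fun x => sgn R (selected_parity x) * walsh R S x) = 0.
Proof.
move=> ltSk; have k0 : (0 < k)%N by exact: (leq_ltn_trans (leq0n _) ltSk).
pose bit (b : cube k) (t : 'I_k) := enum_rank ((true, (b, t)) : coord k).
have /all_sig[free freeP] (b : cube k) : {t | bit b t \notin S}.
  apply: sigW; apply/existsP; apply: contraLR ltSk.
  rewrite negb_exists -leqNgt => /forallP inS; rewrite -{1}(card_ord k).
  have bit_inj : injective (bit b) by move=> t t' /enum_rank_inj[].
  rewrite -(card_image bit_inj); apply/subset_leq_card/subsetP => _ /imageP[t _ ->].
  by have := inS t; rewrite negbK.
pose at_ x := bit (selected x) (free (selected x)).
pose flip x := replace x (at_ x) (~~ x (at_ x)).
(* Only a data bit is flipped, so the address words and hence the selected block stay; a second flip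
   therefore hits the same bit. *)
have sel_flip x : selected (flip x) = selected x.
  by apply: eq_selected => b; rewrite word_replace.
have flipK : involutive flip.
  move=> x; rewrite /flip /at_ -/(at_ x) -/(flip x) sel_flip -/(at_ x).
  by apply/ffunP => i; rewrite !ffunE eqxx; case: eqP => // ->; rewrite negbK.
have par_flip x : selected_parity (flip x) = ~~ selected_parity x.
  rewrite /selected_parity sel_flip (bigD1 (free (selected x))) //=.
  rewrite [in RHS](bigD1 (free (selected x))) //= -addNb; congr addb.
    by rewrite !ffunE eqxx.
  apply: eq_bigr => t tf; rewrite !ffunE (inj_eq enum_rank_inj) !xpair_eqE.
  by rewrite (negPf tf) !andbF.
have walsh_flip x : walsh R S (flip x) = walsh R S x.
  apply: eq_bigr => i iS; rewrite ffunE; case: eqP => // iat.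
  by have := freeP (selected x); rewrite -/(at_ x) -iat iS.
rewrite /expectation; set s := \sum_x _.
suff -> : s = 0 by rewrite mul0r.
have : s = - s.
  rewrite {1}/s (reindex_inj (inv_inj flipK)) -sumrN; apply: eq_bigr => x _.
  by rewrite par_flip walsh_flip /sgn signrN mulNr.
by move=> ?; lra.
Qed.

(** * Choice of the constants *)

Lemma max_influence_le (R : realType) (n : nat) (f : cube n -> bool) (r : R) :
  0 <= r -> (forall i, influence R f i <= r) -> max_influence R f <= r.
Proof.
move=> r0 fr; rewrite /max_influence.
by elim/big_ind: _ => // a b ar br; rewrite ge_max ar br.
Qed.

Theorem theorem1p12 (R : realType) :
  exists C c : R,
    [/\ 0 < C, 0 < c &
      forall N : nat, exists n : nat,
        (N <= n)%N /\
        exists f : cube n -> bool,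
          (forall S : {set 'I_n}, #|S|%:R <= c * ln (n%:R : R) ->
             expectation (fun x : cube n => sgn R (f x) * walsh R S x) = 0) /\
          max_influence R f <= C * (ln (n%:R : R) / n%:R)].
Proof.
have ln2_gt0 : 0 < ln 2 :> R by rewrite ln_gt0 // ltr1n.
have e_gt0 := expR_gt0 (1 : R).
(* With [n = 2 k 2 ^ k], the bound [ln n <= 3 k] turns [c = 1 / 4] into [#|S| <= 3 k / 4 < k], and
   [k ln 2 <= ln n] makes [C ln n / n] at least [2 e / 2 ^ k], the bound on the influences. *)
exists (4 * expR 1 / ln 2), 4^-1; split; first by rewrite divr_gt0 // mulr_gt0.
  by rewrite invr_gt0.
move=> N; pose k := N.+1; exists #|coord k|.
have N_lt : (N < 2 ^ N)%N by exact: ltn_expl.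
have pow_gt0 : (0 < 2 ^ k)%N by rewrite expn_gt0.
have n_gt0 : (0 < #|coord k|)%N by rewrite card_coord !muln_gt0 pow_gt0.
split; first by rewrite card_coord /k; nia.
exists (@selected_parity k); split => [S leS|].
  apply: expectation_selected_parity; rewrite -(ltr_nat R); apply: (le_lt_trans leS).
  have leln : ln #|coord k|%:R <= 3 * k%:R :> R.
    rewrite -[leRHS]expRK ler_ln ?posrE ?expR_gt0 ?ltr0n // card_coord.
    have e2 : 2 <= expR 1 :> R by apply: (le_trans _ (expR_ge1Dx _)); lra.
    rewrite -[3 * k%:R]natrM -[X in expR X]mulr1 expRM_natl.
    (* Here [2 k 2 ^ k <= 2 ^ (3 k) <= e ^ (3 k)], as both [2] and [k] are at most [2 ^ k]. *)
    apply: (@le_trans _ _ (2 ^+ (3 * k))); last by rewrite lerXn2r ?nnegrE ?expR_ge0.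
    rewrite -natrX ler_nat.
    have -> : (3 * k = k + k + k)%N by lia.
    have k_lt : (k < 2 ^ k)%N by exact: ltn_expl.
    by rewrite !expnD mulnA !leq_mul ?(ltnW k_lt) // expnS; lia.
  have : 0 < k%:R :> R by rewrite ltr0n.
  by lra.
have M0 : 0 < (2 ^ k)%:R :> R by rewrite ltr0n.
have leM : 2 * expR 1 / (2 ^ k)%:R <=
    4 * expR 1 / ln 2 * (ln #|coord k|%:R / #|coord k|%:R) :> R.
  have lnn : k%:R * ln 2 <= ln #|coord k|%:R :> R.
    rewrite mulrC mulr_natr -lnXn // -natrX ler_ln ?posrE ?ltr0n //.
    by rewrite ler_nat card_coord; nia.
  apply: (@le_trans _ _ (4 * expR 1 / ln 2 * (k%:R * ln 2 / #|coord k|%:R))).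
    (* Since [n = 2 k 2 ^ k], the factors [k] and [ln 2] cancel and equality holds. *)
    rewrite card_coord !natrM le_eqVlt; apply/orP; left; apply/eqP; field.
    by rewrite !gt_eqF // ltr0n.
  apply: ler_wpM2l; first by rewrite divr_ge0 ?mulr_ge0 ?ltW.
  by rewrite ler_wpM2r ?invr_ge0.
apply: (le_trans _ leM); apply: max_influence_le => [|i].
  by rewrite divr_ge0 ?mulr_ge0 ?ltW.
apply: (le_trans (influence_le_selected R i)).
by rewrite -mulrA ler_wpM2l // probability_selected.
Qed.
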